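(* Let $\mathcal{A}=(Q,\delta,I,\Gamma,p,\mathit{Acc})$ be an $\mathrm{Inf}$-TELA over a finite alphabet $\Sigma$ with $n=|Q|$, and let $\mathcal{B}$ be the Büchi automaton constructed from $\mathcal{A}$ as described in the context. Then $\mathcal{L}(\mathcal{B})=\Sigma^\omega\setminus\mathcal{L}(\mathcal{A})$.
   Context: A (transition-based) Emerson–Lei automaton (TELA) over a finite alphabet $\Sigma$ is a tuple $\mathcal{A}=(Q,\delta,I,\Gamma,p,\mathit{Acc})$ where $Q$ is a finite set of states, $\delta\subseteq Q\times\Sigma\times Q$ is the transition relation, $I\subseteq Q$ the initial states, $\Gamma=\{0,\dots,k-1\}$ a set of colours, $p:\delta\to 2^\Gamma$ a colouring of transitions, and $\mathit{Acc}$ a formula built from $\mathit{true},\mathit{false}$, atoms $\mathrm{Inf}(c),\mathrm{Fin}(c)$ ($c\in\Gamma$) using $\wedge,\vee$. A set $M\subseteq\Gamma$ satisfies $\mathrm{Inf}(c)$ iff $c\in M$ and $\mathrm{Fin}(c)$ iff $c\notin M$, with the usual meaning of $\wedge,\vee,\mathit{true},\mathit{false}$. A run on $w=w_0w_1\dots\in\Sigma^\omega$ from $q$ is a sequence $\rho:\omega\to Q$ with $\rho(0)=q$ and $(\rho(i),w_i,\rho(i+1))\in\delta$ for all $i$; it is accepting iff the union of $p(t)$ over the transitions $t$ occurring infinitely often in $\rho$ satisfies $\mathit{Acc}$. $\mathcal{L}(\mathcal{A})$ is the set of words having an accepting run from some initial state. For $S\subseteq Q$, $\delta(S,a)=\{q'\mid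 \exists q\in S:(q,a,q')\in\delta\}$. An $\mathrm{Inf}$-TELA is a TELA whose $\mathit{Acc}$ contains no $\mathrm{Fin}$ atom. A (transition-based) Büchi automaton is $(Q',\delta',I',F')$ with $F'\subseteq\delta'$; it accepts $w$ iff some run from $I'$ uses transitions of $F'$ infinitely often. Let $\overline{\mathit{Acc}}$ be the propositional formula obtained by negating $\mathit{Acc}$, pushing the negation to the atoms, and writing each resulting $\neg\mathrm{Inf}(c)$ as the propositional variable $c$ (equivalently: swap $\wedge$ and $\vee$ and replace $\mathrm{Inf}(c)$ by $c$). A model is a set $M\subseteq\Gamma$ satisfying $\overline{\mathit{Acc}}$ (variable $c$ true iff $c\in M$). $\mathrm{Min}$ denotes the set of $\subseteq$-minimal models; it is assumed nonempty, and $\mathrm{lex}$ denotes its lexicographically smallest element. For $k\in\omega$, $\lfloor k\rfloor_{\mathrm{even}}$ is the largest even number $\le k$. A level ranking is $f:Q\to\{0,\dots,2n\}$; $\mathrm{rank}(f)=\max_q f(q)$. A level model is $\mu:Q\to\mathrm{Min}$; it is consistent w.r.t. $f$ if $\mu(q)=\mathrm{lex}$ whenever $f(q)$ is even. For $S\subseteq Q$, $f$ is $(S,\mu)$-tight if (i) $\mathrm{rank}(f)=r$ is odd, (ii) $f(S)\supseteq\{1,3,\dots,r\}$, (iii) $f(Q\setminus S)=\{0\}$, (iv) $\mu$ is consistent w.r.t. $f$. $\mathcal{T}$ is the set of all $f$ that are $(Q,\mu)$-tight for some level model $\mu$. For level rankings $f,f'$, level models $\mu,\mu'$ and $a\in\Sigma$,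 write $(f,\mu)\to_a(f',\mu')$ iff $\mu,\mu'$ are consistent w.r.t. $f,f'$ respectively and for all $q\in Q$, $q'\in\delta(q,a)$: (a) $f'(q')\le f(q)$; (b) if $p((q,a,q'))\cap\mu(q)\neq\emptyset$ then $f'(q')\le\lfloor f(q)\rfloor_{\mathrm{even}}$; (c) if $\mu'(q')\ne\mu(q)$ then $f'(q')\le\lfloor f(q)\rfloor_{\mathrm{even}}$. The Büchi automaton $\mathcal{B}=(Q',\delta',I',F')$: $Q'=Q_1\cup Q_2$ with $Q_1=2^Q$ and $Q_2$ the set of tuples $(S,O,f,i,\mu)$ with $S,O\subseteq Q$, $f\in\mathcal{T}$, $i\in\{0,2,\dots,2n-2\}$, $\mu$ a level model, $f$ $(S,\mu)$-tight and $O\subseteq S\cap f^{-1}(i)$. $I'=\{I\}$. $\delta'=\delta_1\cup\delta_2\cup\delta_3$ where $\delta_1$: $S\xrightarrow{a}\delta(S,a)$ for $S\in Q_1$; $\delta_2$: $S\xrightarrow{a}(\delta(S,a),\emptyset,f,0,\mu)$ for every such tuple belonging to $Q_2$; $\delta_3$: $(S,O,f,i,\mu)\xrightarrow{a}(S',O',f',i',\mu')$ (both in $Q_2$) iff $S'=\delta(S,a)$, $(f,\mu)\to_a(f',\mu')$, $\mathrm{rank}(f)=\mathrm{rank}(f')$, and either $O=\emptyset$, $i'=(i+2)\bmod(\mathrm{rank}(f')+1)$ and $O'=f'^{-1}(i')$, or $O\ne\emptyset$, $i'=i$ and $O'=\delta(O,a)\cap f'^{-1}(i)$. $F'$ consists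 of the $\delta_1$-transitions $\emptyset\xrightarrow{a}\emptyset$ and the $\delta_3$-transitions whose source has $O=\emptyset$.
   Formalization: Conditions (a)–(c) of (f,μ)→_a(f',μ') are imposed only for q in S, not all q in Q; in δ3 with O=∅, O' is S'∩f'^{-1}(i') instead of f'^{-1}(i'); (iii) is read as f vanishing outside S. Taken literally, the claim fails. *)

(* Defs.v *)
From mathcomp Require Import all_boot all_order.
From mathcomp Require Import boolp.

Set Implicit Arguments.
Unset Strict Implicit.
Unset Printing Implicit Defensive.

Definition inf_often (P : nat -> Prop) : Prop :=
  forall N : nat, exists2 m : nat, N <= m & P m.

Inductive acc_formula (k : nat) : Type :=
| ATrue
| AFalse
| AInf of 'I_k
| AFin of 'I_k
| AAnd of acc_formula k & acc_formula k
| AOr of acc_formula k & acc_formula k.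

Arguments ATrue {k}.
Arguments AFalse {k}.

Fixpoint acc_sat (k : nat) (M : {set 'I_k}) (phi : acc_formula k) : bool :=
  match phi with
  | ATrue => true
  | AFalse => false
  | AInf c => c \in M
  | AFin c => c \notin M
  | AAnd f g => acc_sat M f && acc_sat M g
  | AOr f g => acc_sat M f || acc_sat M g
  end.

Fixpoint fin_free (k : nat) (phi : acc_formula k) : bool :=
  match phi with
  | ATrue | AFalse | AInf _ => true
  | AFin _ => false
  | AAnd f g | AOr f g => fin_free f && fin_free g
  end.

(* The values of [tcol] outside [tdelta] are never used. *)
Record tela (Sigma : finType) : Type := Tela {
  tstate : finType;
  tdelta : {set tstate * Sigma * tstate};
  tinit : {set tstate};
  tncol : nat;
  tcol : tstate * Sigma * tstate -> {set 'I_tncol};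
  tacc : acc_formula tncol
}.

Definition inf_tela (Sigma : finType) (A : tela Sigma) : bool :=
  fin_free (tacc A).

Section Runs.
Variables (Sigma : finType) (Q : finType) (delta : {set Q * Sigma * Q}).

Definition step (rho : nat -> Q) (w : nat -> Sigma) (i : nat) :
  Q * Sigma * Q := (rho i, w i, rho i.+1).

Definition is_run (w : nat -> Sigma) (q : Q) (rho : nat -> Q) : Prop :=
  rho 0 = q /\ forall i, step rho w i \in delta.

Definition inf_steps (w : nat -> Sigma) (rho : nat -> Q) :
  {set Q * Sigma * Q} := [set t | `[< inf_often (fun i => step rho w i = t) >]].

Definition post (S : {set Q}) (a : Sigma) : {set Q} :=
  [set q' | [exists q in S, (q, a, q') \in delta]].
End Runs.

Definition tela_accepting (Sigma : finType) (A : tela Sigma)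
    (w : nat -> Sigma) (rho : nat -> tstate A) : Prop :=
  acc_sat (\bigcup_(t in inf_steps w rho) tcol t) (tacc A).

Definition tela_lang (Sigma : finType) (A : tela Sigma) (w : nat -> Sigma) :
    Prop :=
  exists (q : tstate A) (rho : nat -> tstate A),
    [/\ q \in tinit A, is_run (tdelta A) w q rho & tela_accepting w rho].

Record buchi (Sigma : finType) : Type := Buchi {
  bstate : finType;
  bdelta : {set bstate * Sigma * bstate};
  binit : {set bstate};
  bfinal : {set bstate * Sigma * bstate};
  bfinal_sub : bfinal \subset bdelta
}.

Definition buchi_lang (Sigma : finType) (B : buchi Sigma) (w : nat -> Sigma) :
    Prop :=
  exists (q : bstate B) (rho : nat -> bstate B),
    [/\ q \in binit B, is_run (bdelta B) w q rho
      & inf_often (fun i => step rho w i \in bfinal B)].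

(* [PNot] only arises from [AFin]: the negation of Fin(c) is Inf(c), and the
   propositional variable c stands for the negation of Inf(c). *)
Inductive prop_formula (k : nat) : Type :=
| PTrue
| PFalse
| PVar of 'I_k
| PNot of 'I_k
| PAnd of prop_formula k & prop_formula k
| POr of prop_formula k & prop_formula k.

Arguments PTrue {k}.
Arguments PFalse {k}.

Fixpoint prop_sat (k : nat) (M : {set 'I_k}) (phi : prop_formula k) : bool :=
  match phi with
  | PTrue => true
  | PFalse => false
  | PVar c => c \in M
  | PNot c => c \notin M
  | PAnd f g => prop_sat M f && prop_sat M g
  | POr f g => prop_sat M f || prop_sat M g
  end.

Fixpoint acc_bar (k : nat) (phi : acc_formula k) : prop_formula k :=
  match phi with
  | ATrue => PFalse
  | AFalse => PTrue
  | AInf c => PVar c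
  | AFin c => PNot c
  | AAnd f g => POr (acc_bar f) (acc_bar g)
  | AOr f g => PAnd (acc_bar f) (acc_bar g)
  end.

Definition min_models (k : nat) (phi : acc_formula k) : {set {set 'I_k}} :=
  [set M | minset (fun N : {set 'I_k} => prop_sat N (acc_bar phi)) M].

(* [enum M] lists M in increasing order; the increasing listings are compared
   lexicographically. *)
Definition lex_le (k : nat) (M N : {set 'I_k}) : bool :=
  ((enum M : seqlexi 'I_k) <= enum N)%O.

(* The default [set0] is returned only when there is no minimal model. *)
Definition lex_model (k : nat) (phi : acc_formula k) : {set 'I_k} :=
  odflt set0 [pick M in min_models phi
                 | [forall N in min_models phi, lex_le M N]].

Definition floor_even (k : nat) : nat := k - odd k.

Section Complement.
Variables (Sigma : finType) (A : tela Sigma).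

Notation Q := (tstate A).
Notation n := #|tstate A|.
Notation delta := (tdelta A).
Notation Min := (min_models (tacc A)).
Notation lex := (lex_model (tacc A)).

Definition level_ranking : finType := {ffun Q -> 'I_(2 * n).+1}.
Definition level_model : finType :=
  {ffun Q -> {M : {set 'I_(tncol A)} | M \in Min}}.

Definition rank (f : level_ranking) : nat := \max_(q : Q) (f q : nat).

Definition level (f : level_ranking) (i : nat) : {set Q} :=
  [set q | f q == i :> nat].

Definition consistent (f : level_ranking) (mu : level_model) : bool :=
  [forall q, ~~ odd (f q) ==> (val (mu q) == lex)].

(* The third condition says that f vanishes outside S; it is vacuous for
   S = Q, so that total rankings can be tight. *)
Definition tight (S : {set Q}) (f : level_ranking) (mu : level_model) : bool :=
  [&& odd (rank f),
      [forall j : 'I_(2 * n).+1,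
         odd j && (j <= rank f) ==> [exists q in S, f q == j]],
      [forall q, (q \notin S) ==> (f q == 0 :> nat)]
    & consistent f mu].

Definition tight_rankings : {set level_ranking} :=
  [set f | [exists mu, tight [set: Q] f mu]].

(* The conditions bear on the transitions leaving S, the set of states that f
   ranks: outside S the value 0 of f is a mere filler and must not bound the
   ranks of the successors. *)
Definition ranking_step (S : {set Q}) (a : Sigma)
    (f : level_ranking) (mu : level_model)
    (f' : level_ranking) (mu' : level_model) : bool :=
  [&& consistent f mu, consistent f' mu'
    & [forall q in S, forall q' in post delta [set q] a,
        [&& f' q' <= f q,
            (tcol (q, a, q') :&: val (mu q) != set0) ==>
              (f' q' <= floor_even (f q))
          & (mu' q' != mu q) ==> (f' q' <= floor_even (f q))]]].

(* Tuples (X, B, f, i, mu), where X is the set of states tracked by the subset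
   construction and B is the breakpoint set. *)
Definition macro_tuple : finType :=
  ({set Q} * {set Q} * level_ranking * 'I_(2 * n) * level_model)%type.

Definition is_macro (m : macro_tuple) : bool :=
  let: (X, B, f, i, mu) := m in
  [&& f \in tight_rankings, ~~ odd i, tight X f mu
    & B \subset X :&: level f i].

Definition comp_state : finType :=
  ({set Q} + {m : macro_tuple | is_macro m})%type.

Definition comp_trans : finType := (comp_state * Sigma * comp_state)%type.

Definition delta1 : {set comp_trans} :=
  [set t : comp_trans |
    match t with
    | (inl X, a, inl X') => X' == post delta X a
    | _ => false
    end].

Definition delta2 : {set comp_trans} :=
  [set t : comp_trans |
    match t with
    | (inl X, a, inr m') =>
        let: (X', B', f', i', mu') := val m' in
        [&& X' == post delta X a, B' == set0 & i' == 0 :> nat]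
    | _ => false
    end].

(* The successor breakpoint set is cut down to X', because level f' 0 also
   contains all the states outside X'. *)
Definition delta3 : {set comp_trans} :=
  [set t : comp_trans |
    match t with
    | (inr m, a, inr m') =>
        let: (X, B, f, i, mu) := val m in
        let: (X', B', f', i', mu') := val m' in
        [&& X' == post delta X a,
            ranking_step X a f mu f' mu',
            rank f == rank f'
          & [&& B == set0,
                i' == (i + 2) %% (rank f').+1 :> nat
              & B' == X' :&: level f' i']
            || [&& B != set0,
                   i' == i
                 & B' == post delta B a :&: level f' i]]
    | _ => false
    end].

Definition comp_delta : {set comp_trans} := delta1 :|: delta2 :|: delta3.

Definition comp_final : {set comp_trans} :=
  [set t in delta1 | (t.1.1 == inl set0) && (t.2 == inl set0)] :|:
  [set t in delta3 |
    match t.1.1 with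
    | inl _ => false
    | inr m => let: (X, B, f, i, mu) := val m in B == set0
    end].

Lemma comp_final_sub : comp_final \subset comp_delta.
Proof.
apply/subsetP => t; rewrite !inE.
by case/orP => /andP[-> _]; rewrite ?orbT.
Qed.

Definition complement_buchi : buchi Sigma :=
  @Buchi Sigma comp_state comp_delta [set inl (tinit A)] comp_final
    comp_final_sub.

End Complement.

(* Main.v *)
(* Since [tacc A] has no Fin atom, a run is rejecting iff the colours it sees
   infinitely often miss some minimal model of the negated condition.

   Soundness: along a run of [A] tracked by an accepting run of the complement,
   the ranks decrease to a limit. If the limit is odd, the model is eventually
   constant and none of its colours is seen any more, so the run is rejecting.
   If it is even, the index cycles until it meets the limit, and then the run
   stays in the breakpoint set forever, contradicting acceptance.

   Completeness: in the run graph of a word outside the language, alternately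
   remove the vertices with finitely many descendants and the vertices all of
   whose outgoing paths avoid one fixed model. As long as infinite paths remain,
   some model can be avoided, for otherwise a path hitting all models in turn
   would be an accepting run. Each round decreases the width of the graph, so
   the number of the stage at which a vertex disappears is at most 2n; it
   serves as the rank of the vertex. *)

Require Import Defs.
From mathcomp Require Import all_boot all_order.
From mathcomp Require Import boolp zify.

Set Implicit Arguments.
Unset Strict Implicit.
Unset Printing Implicit Defensive.

(** * Eventual behaviour of infinite sequences *)

Lemma eventually_forall (T : finType) (P : T -> nat -> Prop) :
    (forall x, exists N, forall m, N <= m -> P x m) ->
  exists N, forall x m, N <= m -> P x m.
Proof.
case/choice => N hN; exists (\max_x N x) => x m hm.
by apply: hN; apply: leq_trans hm; apply: leq_bigmax.
Qed.

Lemma not_inf_often (P : nat -> Prop) :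
  ~ inf_often P -> exists N, forall m, N <= m -> ~ P m.
Proof.
by case/existsNP => N hN; exists N => m Nm Pm; apply: hN; exists m.
Qed.

Lemma inf_often_pigeonhole (T : finType) (P : pred T) (u : nat -> T) :
    inf_often (fun i => P (u i)) ->
  exists2 t, P t & inf_often (fun i => u i = t).
Proof.
move=> hP; apply: contrapT => hn.
have /eventually_forall[N hN] : forall t, exists N, forall m, N <= m ->
    P t -> u m <> t.
  move=> t; case: (boolP (P t)) => Pt; last by exists 0.
  have /not_inf_often[N hN] : ~ inf_often (fun i => u i = t).
    by move=> ht; apply: hn; exists t.
  by exists N => m Nm _; apply: hN.
by have [m Nm Pm] := hP N; apply: (hN (u m) m Nm Pm).
Qed.

Lemma nonincreasing_stabilizes (g : nat -> nat) (N : nat) :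
    (forall i, N <= i -> g i.+1 <= g i) ->
  exists2 K, N <= K & forall i, K <= i -> g i = g K.
Proof.
move=> hg.
have hge i j : N <= i -> i <= j -> g j <= g i.
  move=> Ni /subnK <-; elim: (j - i) => // d IH.
  by apply: leq_trans IH; rewrite addSn; apply: hg; lia.
have ex_v : exists v, `[< exists2 i, N <= i & g i = v >].
  by exists (g N); apply/asboolP; exists N.
case: (ex_minnP ex_v) => v /asboolP[K NK gK] vmin; exists K => // i Ki.
apply/eqP; rewrite eqn_leq hge //= gK; apply: vmin.
by apply/asboolP; exists i => //; lia.
Qed.

(** * Acceptance formulas and minimal models *)

(** The bar is a De Morgan dual whose variables stand for missed colours, and the complement of [C]
    is the set of colours that [C] misses. *)
Lemma prop_sat_compl_bar (k : nat) (C : {set 'I_k}) (phi : acc_formula k) :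
  prop_sat (~: C) (acc_bar phi) = ~~ acc_sat C phi.
Proof.
elim: phi => //= [c|c|f IHf g IHg|f IHf g IHg]; rewrite ?inE //.
- by rewrite IHf IHg negb_and.
- by rewrite IHf IHg negb_or.
Qed.

Lemma prop_sat_bar_mono (k : nat) (phi : acc_formula k) (M N : {set 'I_k}) :
    fin_free phi -> M \subset N ->
  prop_sat M (acc_bar phi) -> prop_sat N (acc_bar phi).
Proof.
move=> hf sMN; elim: phi hf => //= [c _|f IHf g IHg|f IHf g IHg].
- exact: (subsetP sMN).
- by case/andP => hf hg /orP[/(IHf hf)->|/(IHg hg)->]; rewrite ?orbT.
- by case/andP => hf hg /andP[/(IHf hf)-> /(IHg hg)->].
Qed.

(** If the condition failed, the complement of [C] would satisfy [acc_bar phi], and a minimal model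
    inside it would miss [C]. *)
Lemma acc_sat_min_models (k : nat) (phi : acc_formula k) (C : {set 'I_k}) :
    (forall M, M \in min_models phi -> M :&: C != set0) -> acc_sat C phi.
Proof.
move=> hC; apply: contraT; rewrite -prop_sat_compl_bar => hs.
have [M Mmin] := minset_exists (P := fun N => prop_sat N (acc_bar phi)) hs.
rewrite subsets_disjoint setCK -setI_eq0 => MC.
by have := hC M; rewrite inE Mmin MC => /(_ isT).
Qed.

(** [M] lies in the complement of [C], and without Fin atoms [acc_bar phi] is monotone. *)
Lemma min_models_reject (k : nat) (phi : acc_formula k) (M C : {set 'I_k}) :
    fin_free phi -> M \in min_models phi -> M :&: C = set0 ->
  ~~ acc_sat C phi.
Proof.
move=> hf; rewrite inE => /minsetp hM MC; rewrite -prop_sat_compl_bar.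
apply: prop_sat_bar_mono hM => //.
by rewrite subsets_disjoint setCK -setI_eq0 MC.
Qed.

(** The lexicographic order is total, so a least minimal model is found and the default is not
    returned. *)
Lemma lex_model_min (k : nat) (phi : acc_formula k) :
  min_models phi != set0 -> lex_model phi \in min_models phi.
Proof.
case/set0Pn => M0 hM0; rewrite /lex_model; case: pickP => [M /andP[]//|hn].
have := hn [arg min_(M < M0 | M \in min_models phi)
              (enum M : Order.SeqLexiOrder.Exports.seqlexi 'I_k)]%O.
case: Order.TotalTheory.arg_minP => // M hM hmin; rewrite hM /=.
by move/negP; case; apply/forall_inP => N hN; apply: hmin.
Qed.

(** * Runs *)

Section Runs.
Variables (Sigma : finType) (A : tela Sigma) (w : nat -> Sigma).
Local Notation Q := (tstate A).
Local Notation delta := (tdelta A).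
Local Notation edge l q q' := ((q, w l, q') \in delta).

Lemma postP (S : {set Q}) a q' :
  reflect (exists2 q, q \in S & (q, a, q') \in delta) (q' \in post delta S a).
Proof. by rewrite inE; apply: (iffP exists_inP). Qed.

Lemma mem_post (S : {set Q}) a q q' :
  q \in S -> (q, a, q') \in delta -> q' \in post delta S a.
Proof. by move=> hq he; apply/postP; exists q. Qed.

Fixpoint reached (l : nat) : {set Q} :=
  if l is l'.+1 then post delta (reached l') (w l') else tinit A.

(** Allows a run to be built from level [l] on only; the induction prepends one predecessor at a
    time. *)
Lemma run_from_reached (rho : nat -> Q) (l : nat) :
    rho l \in reached l -> (forall i, l <= i -> edge i (rho i) (rho i.+1)) ->
  exists rho' : nat -> Q, [/\ rho' 0 \in tinit A, is_run delta w (rho' 0) rho'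
    & forall i, l <= i -> rho' i = rho i].
Proof.
elim: l rho => [|l IH] rho hl hrho.
  by exists rho; split=> //; split=> // i; apply: hrho.
have /postP[p hp he] := hl.
pose rho1 i := if i == l then p else rho i.
have [||rho' [h0 hr hE]] := IH rho1.
- by rewrite /rho1 eqxx.
- move=> i li; rewrite /rho1.
  have [->|/eqP ne] := eqVneq i l; first by rewrite ifF //; apply/negbTE; lia.
  by rewrite ifF; [apply: hrho; lia | apply/negbTE; lia].
exists rho'; split=> // i li; rewrite hE; last by lia.
by rewrite /rho1 ifF //; apply/negbTE; lia.
Qed.

(** There are finitely many transitions, so if [M] is met infinitely often, a single transition
    meeting [M] recurs. *)
Lemma colour_hits_inf (rho : nat -> Q) (M : {set 'I_(tncol A)}) :
  (M :&: \bigcup_(t in inf_steps w rho) tcol t != set0) <->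
  inf_often (fun i => tcol (step rho w i) :&: M != set0).
Proof.
split=> [/set0Pn[c]|].
  rewrite inE => /andP[cM /bigcupP[t]]; rewrite inE => /asboolP ht ct N.
  have [m Nm mt] := ht N; exists m => //; apply/set0Pn; exists c.
  by rewrite mt inE ct.
case/(inf_often_pigeonhole (P := fun t => tcol t :&: M != set0)) => t.
case/set0Pn => c; rewrite inE => /andP[ct cM] ht.
apply/set0Pn; exists c; rewrite inE cM; apply/bigcupP; exists t => //.
by rewrite inE; apply/asboolP.
Qed.

End Runs.

(** * Words accepted by the complement *)

Section Soundness.
Variables (Sigma : finType) (A : tela Sigma) (w : nat -> Sigma).
Hypothesis hInf : inf_tela A.
Local Notation Q := (tstate A).
Local Notation delta := (tdelta A).
Local Notation macro := {m : macro_tuple A | is_macro m}.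

Definition mset (x : macro) : {set Q} := (val x).1.1.1.1.
Definition mbreak (x : macro) : {set Q} := (val x).1.1.1.2.
Definition mrank (x : macro) : level_ranking A := (val x).1.1.2.
Definition mindex (x : macro) : nat := (val x).1.2.
Definition mmodel (x : macro) : level_model A := (val x).2.

Definition tracked (s : comp_state A) : {set Q} :=
  match s with inl X => X | inr x => mset x end.

Lemma tracked_post (s s' : comp_state A) a :
  (s, a, s') \in comp_delta A -> tracked s' = post delta (tracked s) a.
Proof.
rewrite !inE; case: s s' => [X|[[[[[X B] f] i] mu] hm]];
  case=> [X'|[[[[[X' B'] f'] i'] mu'] hm']] //=; rewrite /mset ?orbF.
- by move/eqP.
- by case/and3P => /eqP.
- by case/and4P => /eqP.
Qed.

Lemma delta3_cond (x : macro) a (s : comp_state A) :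
    (inr x, a, s) \in comp_delta A ->
  exists2 y, s = inr y &
    [/\ ranking_step (mset x) a (mrank x) (mmodel x) (mrank y) (mmodel y),
        rank (mrank x) = rank (mrank y)
      & if mbreak x == set0
        then mindex y = (mindex x + 2) %% (rank (mrank x)).+1 /\
             mbreak y = mset y :&: level (mrank y) (mindex y)
        else mindex y = mindex x /\
             mbreak y = post delta (mbreak x) a :&: level (mrank y) (mindex y)].
Proof.
rewrite !inE; case: s => [X'|y] //=.
case: x y => [[[[[X B] f] i] mu] hm] [[[[[X' B'] f'] i'] mu'] hm'] /=.
rewrite /mset /mrank /mmodel /mbreak /mindex /=.
case/and4P => _ hs /eqP -> hB; eexists; first by reflexivity.
split=> //=; case: (eqVneq B set0) hB => /= [_|_].
  by rewrite orbF => /andP[/eqP-> /eqP->].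
by case/andP => /eqP-> /eqP->.
Qed.

Lemma mindex_even (x : macro) : ~~ odd (mindex x).
Proof. by case: x => [[[[[X B] f] i] mu] hm]; have /and4P[] := hm. Qed.

(** The accepting loop on the empty set is impossible, since every tracked set contains the state of
    [rho]. Hence accepting steps are [delta3] steps, and ranked states are never left. *)
Lemma buchi_run_macro (r : nat -> comp_state A) q (rho : nat -> Q) :
    is_run (comp_delta A) w (inl (tinit A)) r ->
    inf_often (fun i => step r w i \in comp_final A) ->
    q \in tinit A -> is_run delta w q rho ->
  exists (x : nat -> macro) (N : nat),
    [/\ forall i, N <= i -> r i = inr (x i),
        forall i, N <= i -> rho i \in mset (x i)
      & inf_often (fun i => N <= i /\ mbreak (x i) = set0)].
Proof.
move=> [r0 hr] hF qI [rho0 hrho].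
have htr i : rho i \in tracked (r i).
  elim: i => [|i IH]; first by rewrite r0 rho0.
  by rewrite (tracked_post (hr i)); apply: mem_post (hrho i).
have hfin i : step r w i \in comp_final A ->
    exists2 x, r i = inr x & mbreak x = set0.
  rewrite /step inE => /orP[].
    by rewrite inE => /and3P[_ /eqP/= ri _]; have := htr i; rewrite ri inE.
  rewrite inE => /andP[_] /=; case: (r i) => // x; exists x => //.
  by case: x b => [[[[[X B] f] i'] mu] hm] /= /eqP.
have [N _ /hfin[xN rN _]] := hF 0.
have hmac i : N <= i -> exists x, r i = inr x.
  move/subnK <-; elim: (i - N) => [|d [x hx]]; first by exists xN.
  have := hr (d + N); rewrite /step hx => /delta3_cond[y hy _].
  by exists y; rewrite addSn.
pose x i := if r i is inr y then y else xN.
have hx i : N <= i -> r i = inr (x i) by rewrite /x => /hmac[y ->].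
exists x, N; split=> // [i Ni|K].
  by have := htr i; rewrite hx.
have [m Km /hfin[y ry hy]] := hF (maxn K N).
exists m; first by lia.
by split; [lia | rewrite /x ry].
Qed.

Lemma ranking_stepP (X : {set Q}) a (f f' : level_ranking A)
    (mu mu' : level_model A) q q' :
    ranking_step X a f mu f' mu' -> q \in X -> (q, a, q') \in delta ->
  [/\ f' q' <= f q,
      tcol (q, a, q') :&: val (mu q) != set0 -> f' q' <= floor_even (f q)
    & mu' q' != mu q -> f' q' <= floor_even (f q)].
Proof.
case/and3P => _ _ /forall_inP hs qX he.
have /forall_inP/(_ q') := hs q qX.
rewrite (mem_post _ he) ?inE // => /(_ isT)/and3P[h1 /implyP h2 /implyP h3].
by split.
Qed.

Lemma buchi_lang_sound : buchi_lang (complement_buchi A) w -> ~ tela_lang A w.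
Proof.
case=> s [r [sI hr hF]] [q [rho [qI hrho hacc]]].
have {sI}hs : s = inl (tinit A) by move: sI; rewrite inE => /eqP.
rewrite hs {hs} in hr.
have [x [N [hx hX hB]]] := buchi_run_macro hr hF qI hrho.
have hstep i : N <= i ->
  [/\ ranking_step (mset (x i)) (w i) (mrank (x i)) (mmodel (x i))
        (mrank (x i.+1)) (mmodel (x i.+1)),
      rank (mrank (x i)) = rank (mrank (x i.+1))
    & if mbreak (x i) == set0
      then mindex (x i.+1) = (mindex (x i) + 2) %% (rank (mrank (x i))).+1 /\
        mbreak (x i.+1) =
          mset (x i.+1) :&: level (mrank (x i.+1)) (mindex (x i.+1))
      else mindex (x i.+1) = mindex (x i) /\
        mbreak (x i.+1) = post delta (mbreak (x i)) (w i)
                           :&: level (mrank (x i.+1)) (mindex (x i.+1))].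
  move=> Ni; have := hr.2 i; rewrite /step (hx i Ni) => /delta3_cond[y].
  by rewrite (hx i.+1 (leqW Ni)) => -[<-].
have hedge i : (rho i, w i, rho i.+1) \in delta := hrho.2 i.
have hrs i (Ni : N <= i) :=
  ranking_stepP (let: And3 h _ _ := hstep i Ni in h) (hX i Ni) (hedge i).
pose g i : nat := mrank (x i) (rho i).
have [K NK hK] : exists2 K, N <= K & forall i, K <= i -> g i = g K.
  by apply: nonincreasing_stabilizes => i /hrs[].
have hN i : K <= i -> N <= i by lia.
have hrk i : K <= i -> rank (mrank (x i)) = rank (mrank (x K)).
  move/subnK <-; elim: (i - K) => // d <-; rewrite addSn.
  by have [|_ <- _] := hstep (d + K); first by lia.
have [godd|geven] := boolP (odd (g K)).
  (* An odd rank lies strictly above its even floor, so a change of model or a colour of the model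
     would make the rank drop. *)
  have hfl : floor_even (g K) < g K by rewrite /floor_even godd; lia.
  have hmu i : K <= i -> mmodel (x i) (rho i) = mmodel (x K) (rho K).
    move/subnK <-; elim: (i - K) => // d <-; rewrite addSn.
    have dK : K <= d + K by lia.
    have [_ _ h] := hrs _ (hN _ dK).
    apply/eqP; apply: contraT => /h; rewrite -/(g _) -/(g _).
    by rewrite (hK (d + K).+1) ?(hK (d + K)) //; lia.
  have hcol : ~ inf_often (fun i =>
      tcol (step rho w i) :&: val (mmodel (x K) (rho K)) != set0).
    move/(_ K) => [m Km]; rewrite -(hmu m Km) => hm.
    have [_ /(_ hm) h _] := hrs _ (hN _ Km).
    by move: h; rewrite -/(g _) -/(g _) (hK m.+1) ?(hK m) //; lia.
  apply: hcol; apply/colour_hits_inf.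
  by apply/eqP => hM; case: (negP (min_models_reject hInf
    (valP (mmodel (x K) (rho K))) hM)).
set j := g K in hK geven; set R := rank (mrank (x K)) in hrk.
have jR : j < R.+1 by apply: leq_bigmax.
(* A breakpoint set refilled at index [j] contains the run, whose rank stays [j], so it never
   empties again. *)
have hcatch t : K <= t -> mbreak (x t) = set0 -> mindex (x t.+1) = j -> False.
  move=> Kt Bt it.
  have hrho_in d : rho (d + t.+1) \in mbreak (x (d + t.+1)) /\
      mindex (x (d + t.+1)) = j.
    elim: d => [|d [IHb IHi]].
      rewrite add0n; split=> //; have [_ _] := hstep t (hN _ Kt).
      rewrite Bt eqxx it => -[_ ->]; rewrite !inE hX; last by lia.
      by rewrite -/(g _) hK ?eqxx //; lia.
    have [|_ _] := hstep (d + t.+1); first by lia.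
    case: eqP IHb => [->|_ IHb]; first by rewrite inE.
    rewrite addSn IHi => -[-> ->]; split=> //.
    rewrite in_setI (mem_post IHb) //.
    by rewrite inE -/(g _) hK ?eqxx //; lia.
  have [m tm [_ hm]] := hB t.+1.
  by have [] := hrho_in (m - t.+1); rewrite subnK // hm inE.
(* The index is frozen until the breakpoint set empties, which acceptance guarantees. *)
have hnext t : K <= t -> exists2 t', t <= t' &
    mbreak (x t') = set0 /\ mindex (x t') = mindex (x t).
  move=> Kt; have ex_t : exists d, mbreak (x (t + d)) == set0.
    by have [m tm [_ hm]] := hB t; exists (m - t); rewrite subnKC // hm.
  case: (ex_minnP ex_t) => d /eqP hd hmin; exists (t + d); first by lia.
  split=> //; elim: d {hd} hmin => [|d IH] hmin; first by rewrite addn0.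
  have [|_ _] := hstep (t + d); first by lia.
  rewrite ifF; last by apply/negP => /hmin; lia.
  by rewrite addnS => -[-> _]; apply: IH => e /hmin; lia.
have hcount d t : K <= t -> (mindex (x t) + 2 * d.+1) %% R.+1 = j -> False.
  elim: d t => [|d IH] t Kt hd; have [t' tt' [Bt' it']] := hnext t Kt.
    apply: (hcatch t') => //; first by lia.
    have [|_ _] := hstep t'; first by lia.
    by rewrite Bt' eqxx it' hrk; [case=> -> _ | lia].
  apply: (IH t'.+1); first by lia.
  have [|_ _] := hstep t'; first by lia.
  rewrite Bt' eqxx it' hrk; last by lia.
  by case=> -> _; rewrite modnDml -hd; congr (_ %% _); lia.
have hi := mindex_even (x K).
(* With [mindex (x K) = 2a] and [j = 2b] this is [d = b + aR + R], for which
   [2a + 2(d + 1) = 2(a + 1)(R + 1) + j]. *)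
apply: (hcount (j./2 + (mindex (x K))./2 * R + R) K) => //.
rewrite -[RHS](modn_small jR) -(modnMDl (2 * ((mindex (x K))./2).+1) j).
congr (_ %% _); have := odd_double_half (mindex (x K)).
have := odd_double_half j.
by rewrite (negbTE hi) (negbTE geven); nia.
Qed.

End Soundness.

(** * Words rejected by the automaton *)

Section Completeness.
Variables (Sigma : finType) (A : tela Sigma) (w : nat -> Sigma).
Local Notation Q := (tstate A).
Local Notation n := #|tstate A|.
Local Notation delta := (tdelta A).
Local Notation edge l q q' := ((q, w l, q') \in delta).
Local Notation model := {M : {set 'I_(tncol A)} | M \in min_models (tacc A)}.
Local Notation reached := (reached A w).
Implicit Types (H : nat -> {set Q}) (M : model).

(** * Paths and removable vertices in the run graph *)

Fixpoint alive H (m l : nat) (q : Q) : bool :=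
  if m is m'.+1 then
    [exists q', [&& edge l q q', q' \in H l.+1 & alive H m' l.+1 q']]
  else true.

(** Here [m] counts the edges travelled before the edge that meets [M]. *)
Fixpoint hits H M (m l : nat) (q : Q) : bool :=
  [exists q', [&& edge l q q', q' \in H l.+1 &
     if m is m'.+1 then hits H M m' l.+1 q'
     else tcol (q, w l, q') :&: val M != set0]].

(** By finite branching, having paths of every length in [H] amounts to having infinitely many
    descendants there. *)
Definition endless_part H (l : nat) : {set Q} :=
  [set q in H l | `[< forall m, alive H m l q >]].

Definition safe_part H M (l : nat) : {set Q} :=
  [set q in H l | `[< forall m, ~~ hits H M m l q >]].

Definition extendable H : Prop :=
  forall l q, q \in H l -> exists2 q', edge l q q' & q' \in H l.+1.

Lemma aliveW H m l q : alive H m.+1 l q -> alive H m l q.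
Proof.
elim: m l q => [//|m IH] l q /existsP[q' /and3P[e hq' ha]].
by apply/existsP; exists q'; rewrite e hq'; apply: IH.
Qed.

Lemma alive_le H m k l q : m <= k -> alive H k l q -> alive H m l q.
Proof. by move/subnK <-; elim: (k - m) => // d IH /aliveW. Qed.

Lemma alive_step H m l q q' :
  edge l q q' -> q' \in H l.+1 -> alive H m l.+1 q' -> alive H m l q.
Proof.
by move=> e hq' ha; apply: aliveW; apply/existsP; exists q'; rewrite e hq'.
Qed.

(** One of the finitely many successors starts arbitrarily long paths, hence, by truncation, paths
    of every length. *)
Lemma endless_extendable H : extendable (endless_part H).
Proof.
move=> l q; rewrite inE => /andP[_ /asboolP hq]; apply: contrapT => hn.
have /eventually_forall[N hN] : forall q', exists N, forall m, N <= m ->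
    ~~ [&& edge l q q', q' \in H l.+1 & alive H m l.+1 q'].
  move=> q'; apply: contrapT => hb; apply: hn.
  have hall m : [&& edge l q q', q' \in H l.+1 & alive H m l.+1 q'].
    apply: contrapT => hm; apply: hb; exists m => k mk.
    by apply/negP => /and3P[e h ha]; apply: hm; rewrite e h (alive_le mk ha).
  exists q'; first by case/and3P: (hall 0).
  rewrite inE; have /and3P[_ -> _] := hall 0.
  by apply/asboolP => m; case/and3P: (hall m).
by have /existsP[q'] := hq N.+1; apply/negP/hN.
Qed.

(** Following predecessors inside [T] back from a far slice gives arbitrarily long paths from [T L];
    as [T L] is finite, one vertex starts paths of every length. *)
Lemma konig H (T : nat -> {set Q}) (L : nat) :
    (forall l, L <= l -> T l != set0) ->
    (forall l, L <= l -> T l \subset H l) ->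
    (forall l q', L <= l -> q' \in T l.+1 ->
       exists2 q, q \in T l & edge l q q') ->
  exists2 q, q \in T L & q \in endless_part H L.
Proof.
move=> T0 TH hT; apply: contrapT => hn.
have /eventually_forall[N hN] : forall q, exists N, forall m, N <= m ->
    q \in T L -> ~~ alive H m L q.
  move=> q; apply: contrapT => hb; apply: hn.
  have qT : q \in T L.
    by apply: contrapT => qT; apply: hb; exists 0 => m _ /qT.
  exists q => //; rewrite inE (subsetP (TH _ _)) //; apply/asboolP => m.
  apply: contrapT => hm; apply: hb; exists m => k mk _.
  by apply/negP => /(alive_le mk).
(* If no path of length [N] starts in [T L], none of length [N - k] starts in [T (L + k)]; for
   [k = N] this is absurd. *)
have hk k q : k <= N -> q \in T (L + k) -> ~~ alive H (N - k) (L + k) q.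
  elim: k q => [|k IH] q' kN; first by rewrite addn0 subn0; apply: hN.
  rewrite addnS => hq'; have [|q hq e] := hT (L + k) q' _ hq'; first by lia.
  apply: contra (IH q (ltnW kN) hq); rewrite -(subnSK kN) => ha.
  apply/existsP; exists q'; apply/and3P; split=> //.
  by apply: (subsetP (TH _ _) _ hq'); lia.
have /set0Pn[q hq] : T (L + N) != set0 by apply: T0; lia.
by have := hk N q (leqnn N) hq; rewrite subnn.
Qed.

Lemma safe_step H M l q q' :
    q \in safe_part H M l -> edge l q q' -> q' \in H l.+1 ->
  q' \in safe_part H M l.+1 /\ tcol (q, w l, q') :&: val M = set0.
Proof.
rewrite !inE => /andP[_ /asboolP hq] e hq'; rewrite hq'; split.
  apply/asboolP => m; apply: contra (hq m.+1) => hm.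
  by apply/existsP; exists q'; rewrite e hq'.
apply/eqP; apply: contraT => hc; apply: contraNT (hq 0) => _.
by apply/existsP; exists q'; rewrite e hq'.
Qed.

Lemma safe_persists H M l k :
    extendable H -> l <= k -> safe_part H M l != set0 ->
  safe_part H M k != set0.
Proof.
move=> hH /subnK <- hl; elim: (k - l) => // d /set0Pn[q hq].
have [q' e hq'] : exists2 q', edge (d + l) q q' & q' \in H (d + l).+1.
  by apply: hH; move: hq; rewrite inE => /andP[].
by have [h _] := safe_step hq e hq'; apply/set0Pn; exists q'.
Qed.

(** The successor is taken on a shortest path to a hit, so the distance strictly decreases. *)
Lemma hits_successor H M l q :
    (exists m, hits H M m l q) ->
  exists q', [/\ edge l q q', q' \in H l.+1 &
    tcol (q, w l, q') :&: val M != set0 \/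
    forall m, hits H M m l q -> exists2 k, k < m & hits H M k l.+1 q'].
Proof.
move=> ex_h; case: (ex_minnP ex_h) => -[|m] /existsP[q' /and3P[e hq' h]] hmin.
  by exists q'; split=> //; left.
exists q'; split=> //; right => k /hmin mk; exists m => //.
Qed.

(* The run aims at the minimal models in a round-robin fashion, always moving
   along a shortest path to a transition coloured by the current one. *)
Lemma fair_run H l0 q0 :
    (forall l, H l \subset reached l) -> q0 \in H l0 ->
    (forall M l, safe_part H M l = set0) -> model ->
  tela_lang A w.
Proof.
move=> Hr hq0 hsafe M0.
have hhit M l q : q \in H l -> exists m, hits H M m l q.
  move=> hq; apply: contrapT => hn.
  suff : q \in safe_part H M l by rewrite hsafe inE.
  rewrite inE hq; apply/asboolP => m; apply/negP => hm.
  by apply: hn; exists m.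
(* The counter modulo the number of models names the model aimed at; it advances at each hit. *)
pose Ms := enum {: model}; pose tgt c := nth M0 Ms (c %% size Ms).
have /choice[next hnext] : forall x : nat * Q * nat, exists q',
    x.1.2 \in H x.1.1 -> [/\ edge x.1.1 x.1.2 q', q' \in H x.1.1.+1 &
    tcol (x.1.2, w x.1.1, q') :&: val (tgt x.2) != set0 \/
    forall m, hits H (tgt x.2) m x.1.1 x.1.2 ->
      exists2 k, k < m & hits H (tgt x.2) k x.1.1.+1 q'].
  case=> [[l q] c] /=; case: (boolP (q \in H l)) => hq; last by exists q.
  by have [q' h] := hits_successor (hhit (tgt c) l q hq); exists q'.
pose good l q c q' := tcol (q, w l, q') :&: val (tgt c) != set0.
pose nxt l s : Q * nat :=
  let q' := next (l, s.1, s.2) in (q', s.2 + good l s.1 s.2 q').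
(* The run starts at level [l0]; earlier values are placeholders. *)
pose fix st l : Q * nat :=
  if l is l'.+1 then if l0 <= l' then nxt l' (st l') else (q0, 0)
  else (q0, 0).
have st0 : st l0 = (q0, 0) by rewrite /st; case: (l0) => //= l; rewrite ltnn.
have stS l : l0 <= l -> st l.+1 = nxt l (st l) by move=> /= ->.
have stH l : l0 <= l -> (st l).1 \in H l.
  move/subnK <-; elim: (l - l0) => [|d IH]; first by rewrite st0.
  rewrite addSn stS ?leq_addl //=.
  by have [] := hnext (d + l0, (st (d + l0)).1, (st (d + l0)).2) IH.
have hst l (ll : l0 <= l) := hnext (l, (st l).1, (st l).2) (stH l ll).
pose rho l := (st l).1; pose c l := (st l).2.
have rhoS l : l0 <= l -> rho l.+1 = next (l, rho l, c l).
  by move=> ll; rewrite /rho stS.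
have cS l : l0 <= l -> c l.+1 = c l + good l (rho l) (c l) (rho l.+1).
  by move=> ll; rewrite rhoS // /c stS.
(* Induction on the distance to a hit: until it occurs, the counter and so the target stay fixed. *)
have prog m l : l0 <= l -> hits H (tgt (c l)) m l (rho l) ->
    exists l', [/\ l <= l', c l' = c l & good l' (rho l') (c l') (rho l'.+1)].
  elim/ltn_ind: m l => m IH l ll hm.
  have [hg|hg] := boolP (good l (rho l) (c l) (rho l.+1)).
    by exists l; split.
  have [_ _ [hg'|/(_ m hm)[k km hk]]] := hst l ll.
    by move: hg; rewrite /good rhoS // hg'.
  have cE : c l.+1 = c l by rewrite cS // (negbTE hg) addn0.
  have [||l' [ll' cl' gl']] := IH k km l.+1; first by lia.
    by rewrite cE rhoS.
  by exists l'; split=> //; [lia | rewrite cl'].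
have prog1 l : l0 <= l ->
    exists l', [/\ l <= l', c l' = c l & good l' (rho l') (c l') (rho l'.+1)].
  by move=> ll; have [m] := hhit (tgt (c l)) l (rho l) (stH l ll); apply: prog.
have progd d l : l0 <= l -> exists l',
    [/\ l <= l', c l' = c l + d & good l' (rho l') (c l') (rho l'.+1)].
  move=> ll; elim: d => [|d [l1 [ll1 cl1 gl1]]].
    by rewrite addn0; apply: prog1.
  have [|l' [ll' cl' gl']] := prog1 l1.+1; first by lia.
  exists l'; split=> //; first by lia.
  by rewrite cl' cS ?gl1 ?cl1; lia.
have [||rho' [r0 hr hE]] := run_from_reached (w := w) (rho := rho) (l := l0).
- by apply: (subsetP (Hr l0)); apply: stH.
- by move=> i li; rewrite rhoS //; have [] := hst i li.
exists (rho' 0), rho'; split=> //; apply: acc_sat_min_models => M hM.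
apply/colour_hits_inf => N; pose M1 : model := exist _ M hM.
have hidx : index M1 Ms < size Ms by rewrite index_mem mem_enum.
have ll : l0 <= maxn N l0 by lia.
set l := maxn N l0 in ll.
(* This increment brings the counter to [c l * size Ms + index M1 Ms], so the model hit is [M1]. *)
have [l' [ll' cl' gl']] := progd (index M1 Ms + c l * (size Ms).-1) l ll.
exists l'; first by rewrite /l in ll'; lia.
rewrite /step !hE; [|lia..].
move: gl'; rewrite /good /tgt; have -> : c l' = c l * size Ms + index M1 Ms.
  by rewrite cl' -[size Ms in RHS]prednK; [nia | lia].
by rewrite modnMDl modn_small // nth_index ?mem_enum.
Qed.

(** * The successive layers of the run graph of a rejected word *)

Hypothesis hL : ~ tela_lang A w.
Variable lexM : model.

(** The default [lexM] is taken only when every safe part is empty, so that nothing is removed. *)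
Definition stage_model H : model :=
  if pselect (exists M, exists l, safe_part H M l != set0) is left ex_M
  then projT1 (cid ex_M) else lexM.

(* Each odd stage removes the vertices that are safe for one single model, so
   that the rank of a vertex determines its model; condition (c) of the
   transition relation forces this. *)
Fixpoint layer (j : nat) : nat -> {set Q} :=
  if j is j'.+1 then
    let H := layer j' in
    if odd j' then fun l => H l :\: safe_part H (stage_model H) l
    else endless_part H
  else reached.

Lemma layerS_odd j l : odd j ->
  layer j.+1 l = layer j l :\: safe_part (layer j) (stage_model (layer j)) l.
Proof. by move=> /= ->. Qed.

Lemma layerS_even j : ~~ odd j -> layer j.+1 = endless_part (layer j).
Proof. by move=> /= /negbTE ->. Qed.

Arguments layer : simpl never.

Lemma layerS_sub j l : layer j.+1 l \subset layer j l.
Proof.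
have [oj|ej] := boolP (odd j); first by rewrite layerS_odd // subsetDl.
by rewrite layerS_even //; apply/subsetP => q; rewrite inE => /andP[].
Qed.

Lemma layer_anti i j l : i <= j -> layer j l \subset layer i l.
Proof.
move/subnK <-; elim: (j - i) => // d; apply: subset_trans.
by rewrite addSn; apply: layerS_sub.
Qed.

(** Safety passes to successors and paths extend backwards, so no stage removes a vertex while
    keeping a successor. This makes ranks nonincreasing along edges. *)
Lemma layer_pred j l q q' :
  q \in reached l -> edge l q q' -> q' \in layer j l.+1 -> q \in layer j l.
Proof.
move=> hq e; elim: j => [//|j IH] hq'.
have hj' := subsetP (layerS_sub j l.+1) _ hq'; have hj := IH hj'.
have [oj|ej] := boolP (odd j); move: hq'.
  rewrite !layerS_odd // !in_setD hj andbT => /andP[hn _].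
  by apply: contra hn => hs; have [] := safe_step hs e hj'.
rewrite !layerS_even // !inE hj hj' /= => /asboolP ha; apply/asboolP => m.
exact: alive_step (ha m).
Qed.

Lemma layer_has_pred j l q' :
  q' \in layer j l.+1 -> exists2 q, q \in layer j l & edge l q q'.
Proof.
move=> hq'; have /postP[q hq e] := subsetP (layer_anti l.+1 (leq0n j)) _ hq'.
by exists q => //; apply: layer_pred e hq'.
Qed.

Lemma layer_empty_le j l k : l <= k -> layer j l = set0 -> layer j k = set0.
Proof.
move/subnK <- => hl; elim: (k - l) => // d IH; apply/setP => q'.
rewrite inE addSn; apply/negP => /layer_has_pred[q].
by rewrite IH inE.
Qed.

Lemma layer_odd_extendable j : odd j -> extendable (layer j).
Proof.
by case: j => // j oj; rewrite layerS_even //; apply: endless_extendable.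
Qed.

(** If no model had a safe vertex, [fair_run] would make the word accepted. Odd layers are
    extendable, so safe vertices persist at all later levels. *)
Lemma layer_odd_safe j l0 :
    odd j -> layer j l0 != set0 ->
  exists L, forall l, L <= l ->
    safe_part (layer j) (stage_model (layer j)) l != set0.
Proof.
move=> oj /set0Pn[q0 hq0].
have [L hL'] : exists l, safe_part (layer j) (stage_model (layer j)) l != set0.
  rewrite /stage_model; case: pselect => [ex_M|hn].
    exact: projT2 (cid ex_M).
  case: hL; apply: (fair_run (H := layer j) (l0 := l0) (q0 := q0)) => //.
    by move=> l; apply: (layer_anti l (leq0n j)).
  move=> M l; apply/eqP; apply: contraT => hM; case: hn; by exists M, l.
exists L => l Ll; apply: safe_persists hL' => //.
exact: layer_odd_extendable.
Qed.

Lemma layer_width i :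
  exists L, forall l, L <= l -> #|layer (2 * i) l| <= n - i.
Proof.
elim: i => [|i [L1 h1]]; first by exists 0 => l; rewrite subn0 max_card.
have odd2i : odd (2 * i).+1 by rewrite oddS oddM.
rewrite mulnS.
case: (pselect (exists l, layer (2 * i).+1 l != set0)) => [[l0]|hn].
  case/layer_odd_safe => // L2 h2; exists (maxn L1 L2) => l.
  rewrite geq_max => /andP[/h1 c1 /h2 c2].
  have hlt : #|layer (2 * i).+2 l| < #|layer (2 * i).+1 l|.
    apply: proper_card; rewrite properE layerS_sub.
    case/set0Pn: c2 => q hq; apply/subsetPn; exists q.
      by move: hq; rewrite inE => /andP[].
    by rewrite layerS_odd // in_setD hq.
  have := subset_leq_card (layerS_sub (2 * i) l).
  by rewrite add2n; lia.
(* With no vertex left after the endless part, the next layer is empty and any bound holds. *)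
exists 0 => l _; apply: leq_trans (_ : 0 <= _) => //; rewrite leqn0 cards_eq0.
have hl : layer (2 * i).+1 l = set0.
  by apply/eqP; apply: contraT => hl; case: hn; exists l.
by rewrite -subset0 -hl add2n; apply: layerS_sub.
Qed.

(** * Ranks and models read off the layers *)

(** As the layers decrease, on reached vertices this count is the last [j <= 2 * n] whose layer
    contains the vertex. *)
Definition vrank (l : nat) (q : Q) : nat :=
  \sum_(j < 2 * n) (q \in layer j.+1 l).

Lemma vrank_max l q : vrank l q <= 2 * n.
Proof.
rewrite -[leqRHS](card_ord (2 * n)) -sum1_card.
by apply: leq_sum => i _; apply: leq_b1.
Qed.

Lemma vrank_geq l q j :
  q \in reached l -> j <= 2 * n -> (j <= vrank l q) = (q \in layer j l).
Proof.
move=> hq; rewrite /vrank; elim: (2 * n) j => [|m IH] j.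
  by rewrite leqn0 => /eqP ->; rewrite hq.
rewrite big_ord_recr /= => jm.
have [hm|hm] := boolP (q \in layer m.+1 l).
  have le_m : m <= \sum_(i < m) (q \in layer i.+1 l).
    by rewrite IH //; apply: (subsetP (layerS_sub m l)).
  by rewrite (subsetP (layer_anti l jm)) // addn1 (leq_trans jm).
rewrite addn0; have [j_m|j_m] := leqP j m; first exact: IH.
have -> : j = m.+1 by lia.
rewrite (negbTE hm); apply/negbTE; rewrite -ltnNge ltnS.
rewrite -[leqRHS](card_ord m) -sum1_card.
by apply: leq_sum => i _; apply: leq_b1.
Qed.

Lemma vrank_out l q : q \notin reached l -> vrank l q = 0.
Proof.
move=> hq; apply: big1 => j _; apply/eqP; rewrite eqb0.
by apply: contra hq; apply: (subsetP (layer_anti l (leq0n _))).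
Qed.

Lemma vrank_layer l q : q \in reached l -> q \in layer (vrank l q) l.
Proof. by move=> hq; rewrite -vrank_geq // vrank_max. Qed.

Lemma vrank_le l q q' :
  q \in reached l -> edge l q q' -> vrank l.+1 q' <= vrank l q.
Proof.
move=> hq e; have hq' : q' \in reached l.+1 by apply: mem_post e.
rewrite vrank_geq ?vrank_max //; apply: layer_pred e _ => //.
exact: vrank_layer.
Qed.

(** The vertex is in the layer of its rank but not in the next, so it was removed as safe. An odd
    rank is below [2 * n], so the next layer is counted. *)
Lemma odd_vrank_safe l q :
    q \in reached l -> odd (vrank l q) ->
  q \in safe_part (layer (vrank l q)) (stage_model (layer (vrank l q))) l.
Proof.
move=> hq ho; have hlt : vrank l q < 2 * n.
  rewrite ltn_neqAle vrank_max andbT; apply: contraTneq ho => ->.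
  by rewrite oddM.
apply: contraT => hs.
have : q \in layer (vrank l q).+1 l.
  by rewrite layerS_odd // in_setD hs vrank_layer.
by rewrite -vrank_geq // ltnn.
Qed.

(** A rank that drops from an odd value falls to the even floor. If it stays odd, both ends are
    removed at the same stage, for the same model, whose colours the edge avoids. *)
Lemma vrank_floor l q q' :
    q \in reached l -> edge l q q' ->
    vrank l.+1 q' <= floor_even (vrank l q) \/
  [/\ vrank l.+1 q' = vrank l q, odd (vrank l q) &
      tcol (q, w l, q') :&: val (stage_model (layer (vrank l q))) = set0].
Proof.
move=> hq e; have hq' : q' \in reached l.+1 by apply: mem_post e.
have := vrank_le hq e; rewrite /floor_even.
have [ho|_] := boolP (odd (vrank l q)); last by left; rewrite subn0.
rewrite leq_eqVlt => /orP[/eqP hE|]; last by left; lia.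
right; split=> //; have [|_ -> //] := safe_step (odd_vrank_safe hq ho) e.
by rewrite -hE; apply: vrank_layer.
Qed.

Definition level_f (l : nat) : level_ranking A := [ffun q => inord (vrank l q)].

Definition level_mu (l : nat) : level_model A :=
  [ffun q => if odd (vrank l q) then stage_model (layer (vrank l q)) else lexM].

Lemma level_fE l q : level_f l q = vrank l q :> nat.
Proof. by rewrite ffunE inordK // ltnS vrank_max. Qed.

Hypothesis lexME : val lexM = lex_model (tacc A).

Lemma level_consistent l : consistent (level_f l) (level_mu l).
Proof.
apply/forallP => q; apply/implyP; rewrite level_fE ffunE => /negbTE ->.
by rewrite lexME.
Qed.

Lemma level_step l :
  ranking_step (reached l) (w l) (level_f l) (level_mu l)
    (level_f l.+1) (level_mu l.+1).
Proof.
rewrite /ranking_step !level_consistent /=.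
apply/forall_inP => q hq; apply/forall_inP => q' /postP[q1].
rewrite inE => /eqP -> {q1} e; rewrite !level_fE vrank_le //=.
have [hle|[hE ho hc]] := vrank_floor hq e; first by rewrite hle !implybT.
by rewrite !ffunE hE ho hc !eqxx.
Qed.

(** * Tightness on late levels *)

Hypothesis reached_neq0 : forall l, reached l != set0.

Lemma eventually_tight :
  exists r L, forall l, L <= l ->
    tight (reached l) (level_f l) (level_mu l) /\ rank (level_f l) = r.
Proof.
have [L2n h2n] := layer_width n; rewrite subnn in h2n.
(* The rank [r] is the last stage that leaves every slice nonempty; the width bound keeps it below
   [2 * n]. *)
have ex_r : exists r, `[< forall l, layer r l != set0 >].
  by exists 0; apply/asboolP.
have r_lt r : `[< forall l, layer r l != set0 >] -> r <= (2 * n).-1.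
  move/asboolP => hr; rewrite -ltnS; apply: contraLR (h2n _ (leqnn L2n)).
  rewrite -leqNgt -ltnNge => hle; rewrite card_gt0; apply: contra (hr L2n).
  rewrite -!subset0; apply: subset_trans; apply: layer_anti.
  by apply: leq_trans hle; apply: leqSpred.
have n0 : 0 < n.
  by case/set0Pn: (reached_neq0 0) => q _; apply/card_gt0P; exists q.
case: (ex_maxnP ex_r r_lt) => r hr rmax; have {r_lt} := r_lt r hr.
move: hr => /asboolP hr hr2n; exists r.
have [L1 hL1] : exists L1, layer r.+1 L1 = set0.
  apply: contrapT => hn; suff /rmax : `[< forall l, layer r.+1 l != set0 >].
    by rewrite ltnn.
  by apply/asboolP => l; apply/eqP => hl; apply: hn; exists l.
(* For even [r], [konig] would give an endless vertex in the empty slice [layer r.+1 L1]. *)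
have oddr : odd r.
  apply: contraT => er.
  have [|//|l q' _|q _ hq] := konig (H := layer r) (T := layer r) (L := L1).
  - by move=> l _.
  - exact: layer_has_pred.
  by move: hL1; rewrite layerS_even // => /setP/(_ q); rewrite hq inE.
(* Each odd [j] up to [r] occurs as the rank of the vertices removed at stage [j], present on all
   late levels. *)
have /eventually_forall[L3 hL3] : forall j : 'I_(2 * n).+1, exists L,
    forall l, L <= l -> odd j && (j <= r) ->
    exists2 q, q \in reached l & vrank l q = j.
  move=> j; have [/andP[oj jr]|_] := boolP (odd j && _); last by exists 0.
  have [] := layer_odd_safe (l0 := 0) oj.
    apply: contra (hr 0); rewrite -!subset0; apply: subset_trans.
    exact: layer_anti.
  move=> L hsafe; exists L => l /hsafe/set0Pn[q hq] _.
  have qj : q \in layer j l by move: hq; rewrite inE => /andP[].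
  have qr : q \in reached l := subsetP (layer_anti l (leq0n j)) _ qj.
  exists q => //; apply/eqP; rewrite eqn_leq vrank_geq // ?qj; last by lia.
  rewrite andbT leqNgt vrank_geq //; last by lia.
  by rewrite layerS_odd // in_setD hq.
exists (maxn L1 L3) => l; rewrite geq_max => /andP[L1l L3l].
have hle q : vrank l q <= r.
  have [qr|/vrank_out -> //] := boolP (q \in reached l).
  rewrite leqNgt vrank_geq //; last by lia.
  by rewrite (layer_empty_le L1l hL1) inE.
have hrank : rank (level_f l) = r.
  apply/eqP; rewrite eqn_leq; apply/andP; split.
    by apply/bigmax_leqP => q _; rewrite level_fE.
  case/set0Pn: (hr l) => q hq; apply: (bigmax_sup q) => //.
  rewrite level_fE vrank_geq //; last by lia.
  exact: subsetP (layer_anti l (leq0n r)) _ hq.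
split=> //; apply/and4P; split.
- by rewrite hrank.
- apply/forallP => j; apply/implyP; rewrite hrank => hj.
  have [q qr hq] := hL3 j l L3l hj; apply/exists_inP; exists q => //.
  by apply/eqP/val_inj; rewrite /= level_fE.
- by apply/forall_inP => q hq; rewrite level_fE vrank_out.
- exact: level_consistent.
Qed.

(** Passing from [X] to all states keeps the witnesses for the odd ranks and makes the vanishing
    condition vacuous. *)
Lemma tight_total (X : {set Q}) (f : level_ranking A) (mu : level_model A) :
  tight X f mu -> f \in tight_rankings A.
Proof.
case/and4P => h1 /forallP h2 _ h4; rewrite inE; apply/existsP; exists mu.
apply/and4P; split=> //; last by apply/forall_inP => q; rewrite inE.
apply/forallP => j; apply/implyP => hj.
have /existsP[q /andP[_ hq]] := implyP (h2 j) hj.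
by apply/existsP; exists q; rewrite inE.
Qed.

(** * The accepting run of the complement *)

Section BuchiRun.
Variables (r L : nat).
Hypothesis hr : forall l, L < l ->
  tight (reached l) (level_f l) (level_mu l) /\ rank (level_f l) = r.

(** The [delta2] step leaves level [L], so the process starts with [(set0, 0)] at level [L.+1];
    earlier values are placeholders. *)
Fixpoint breakpoint (l : nat) : {set Q} * nat :=
  if l is l'.+1 then
    if L < l' then
      let: (B, i) := breakpoint l' in
      if B == set0 then
        let i' := (i + 2) %% r.+1 in (reached l :&: level (level_f l) i', i')
      else (post delta B (w l') :&: level (level_f l) i, i)
    else (set0, 0)
  else (set0, 0).

Lemma breakpoint_init : breakpoint L.+1 = (set0, 0).
Proof. by rewrite /= ltnn. Qed.

Lemma breakpointS l : L < l -> breakpoint l.+1 =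
  let: (B, i) := breakpoint l in
  if B == set0 then
    let i' := (i + 2) %% r.+1 in
    (reached l.+1 :&: level (level_f l.+1) i', i')
  else (post delta B (w l) :&: level (level_f l.+1) i, i).
Proof. by move=> /= ->. Qed.

Arguments breakpoint : simpl never.

Lemma r_odd : odd r.
Proof. by have [/and4P[+ _ _ _] rE] := hr (ltnSn L); rewrite rE. Qed.

Lemma r_lt : r < 2 * n.
Proof.
have [_ <-] := hr (ltnSn L); rewrite ltn_neqAle; apply/andP; split.
  have [_ ->] := hr (ltnSn L).
  by apply: contraTneq r_odd => ->; rewrite oddM.
by apply/bigmax_leqP => q _; rewrite -ltnS.
Qed.

Lemma breakpoint_spec l : L < l ->
  [/\ ~~ odd (breakpoint l).2, (breakpoint l).2 < r &
      (breakpoint l).1 \subset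
        reached l :&: level (level_f l) (breakpoint l).2].
Proof.
have r0 : 0 < r by case: r r_odd.
elim: l => // l IH; rewrite ltnS leq_eqVlt => /orP[/eqP <-|Ll].
  by rewrite breakpoint_init; split; rewrite ?sub0set.
move: (IH Ll); rewrite breakpointS //; case: (breakpoint l) => B i.
move=> /= [ei ir sB]; case: eqP => _ /=.
  (* Since [r] is odd, reduction modulo [r.+1] preserves parity, and an even residue differs from
     [r]. *)
  have e : ~~ odd ((i + 2) %% r.+1).
    by rewrite odd_mod ?oddD ?(negbTE ei) //= r_odd.
  split=> //; have : (i + 2) %% r.+1 < r.+1 by rewrite ltn_pmod.
  rewrite ltnS leq_eqVlt => /orP[/eqP hE|//].
  by move: e; rewrite hE r_odd.
split=> //; apply: setSI; apply/subsetP => q' /postP[q qB e].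
by apply: mem_post e; have := subsetP sB _ qB; rewrite inE => /andP[].
Qed.

(** A set that never empties keeps an even index [i] and consists of vertices of rank [i], linked by
    predecessors. By [konig] one of them is endless in [layer i], so its rank exceeds [i]. *)
Lemma breakpoint_empties N : exists2 l, maxn N L < l & (breakpoint l).1 = set0.
Proof.
apply: contrapT => hn; set L1 := (maxn N L).+1.
have hL1 l : L1 <= l -> L < l by rewrite /L1; lia.
have hB l : L1 <= l -> (breakpoint l).1 != set0.
  by move=> Ll; apply/eqP => hB; apply: hn; exists l.
have hS l : L1 <= l -> breakpoint l.+1 =
    (post delta (breakpoint l).1 (w l) :&:
       level (level_f l.+1) (breakpoint l).2, (breakpoint l).2).
  move=> Ll; rewrite breakpointS ?hL1 //; have := hB l Ll.
  by case: (breakpoint l) => B i /= /negbTE ->.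
set i := (breakpoint L1).2.
have hi l : L1 <= l -> (breakpoint l).2 = i.
  move/subnK <-; elim: (l - L1) => // d IH.
  by rewrite addSn hS ?leq_addl.
have [ei ir _] := breakpoint_spec (hL1 _ (leqnn L1)); rewrite -/i in ei ir.
have hrank l q : L1 <= l -> q \in (breakpoint l).1 ->
    q \in reached l /\ vrank l q = i.
  move=> Ll hq; have [_ _ /subsetP/(_ q hq)] := breakpoint_spec (hL1 _ Ll).
  by rewrite hi // in_setI inE level_fE => /andP[-> /eqP].
have [//|l Ll|l q' Ll|q hq] :=
    konig (H := layer i) (T := fun l => (breakpoint l).1) (L := L1).
- apply/subsetP => q /(hrank l q Ll)[qr <-]; exact: vrank_layer.
- by rewrite hS //= inE => /andP[/postP[q hq e] _]; exists q.
have [qr qi] := hrank _ _ (leqnn L1) hq => hend.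
have : q \in layer i.+1 L1 by rewrite layerS_even.
by rewrite -vrank_geq ?qi ?ltnn //; have := r_lt; lia.
Qed.

Definition macro_at (l : nat) : macro_tuple A :=
  (reached l, (breakpoint l).1, level_f l,
   insubd (Ordinal r_lt) (breakpoint l).2,
   level_mu l).

Lemma macro_atP l : L < l -> is_macro (macro_at l).
Proof.
move=> Ll; have [ht _] := hr Ll; have [ei ir sB] := breakpoint_spec Ll.
rewrite /is_macro /= (tight_total ht) ht insubdK; last first.
  exact: ltn_trans ir r_lt.
by rewrite ei sB.
Qed.

Definition comp_run (l : nat) : comp_state A :=
  if L < l then if insub (macro_at l) is Some x then inr x else inl set0
  else inl (reached l).

Lemma comp_run_macro l : L < l ->
  exists2 x, comp_run l = inr x & val x = macro_at l.
Proof.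
move=> Ll; rewrite /comp_run Ll (insubT _ (macro_atP Ll)).
by eexists; first by reflexivity.
Qed.

Lemma comp_run_accepts : buchi_lang (complement_buchi A) w.
Proof.
have idx l : L < l -> (insubd (Ordinal r_lt)
    (breakpoint l).2 : 'I_(2 * n)) = (breakpoint l).2 :> nat.
  move=> Ll; have [_ ir _] := breakpoint_spec Ll.
  by rewrite insubdK //; apply: ltn_trans ir r_lt.
have h3 l : L < l -> (comp_run l, w l, comp_run l.+1) \in delta3 A.
  move=> Ll; have [x -> hx] := comp_run_macro Ll.
  have [y -> hy] := comp_run_macro (leqW Ll); rewrite inE hx hy /macro_at.
  have [_ -> ] := hr Ll; have [_ ->] := hr (leqW Ll).
  rewrite level_step !eqxx /= (idx l Ll) (idx l.+1 (leqW Ll)).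
  rewrite breakpointS //; case: (breakpoint l) => B i /=.
  by case: (B == set0) => /=; rewrite !eqxx.
exists (inl (tinit A)), comp_run; split.
- by rewrite inE.
- split=> // l; rewrite /step !in_setU; case: (ltngtP l L) => lL.
  + rewrite /comp_run ltnNge (ltnW lL) ltnNge lL /=.
    by rewrite inE eqxx.
  + by rewrite h3 // orbT.
  have [x hx hxE] := comp_run_macro (ltnSn L).
  rewrite lL hx /comp_run ltnn [in X in _ || X || _]inE hxE /macro_at.
  by rewrite idx // breakpoint_init /= !eqxx orbT.
move=> N; have [l] := breakpoint_empties N.
rewrite gtn_max => /andP[Nl Ll] hB; exists l; first exact: ltnW.
rewrite /step in_setU; apply/orP; right; rewrite inE h3 //=.
by have [x -> hx] := comp_run_macro Ll; rewrite hx /macro_at hB.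
Qed.

End BuchiRun.
End Completeness.

(** Once no state is reached, the subset part loops on the empty set. No ranked state exists there,
    as a tight ranking has odd rank but would vanish everywhere. *)
Lemma empty_reached_accepts (Sigma : finType) (A : tela Sigma) w L :
  reached A w L = set0 -> buchi_lang (complement_buchi A) w.
Proof.
move=> hL; have h0 l : L <= l -> reached A w l = set0.
  move/subnK <-; elim: (l - L) => // d IH; rewrite addSn /= IH.
  by apply/setP => q; rewrite [RHS]inE; apply/negP => /postP[?]; rewrite inE.
exists (inl (tinit A)), (fun l => inl (reached A w l)); split.
- by rewrite inE.
- by split=> // l; rewrite !in_setU [_ \in delta1 A]inE /= eqxx.
move=> N; exists (maxn N L); first by lia.
rewrite /step in_setU; apply/orP; left; rewrite inE; apply/andP; split.
  by rewrite inE /= eqxx.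
by rewrite !h0 /= ?eqxx //; lia.
Qed.

Theorem theorem1 (Sigma : finType) (A : tela Sigma)
    (hInf : inf_tela A) (hMin : min_models (tacc A) != set0) :
  forall w : nat -> Sigma,
    buchi_lang (complement_buchi A) w <-> ~ tela_lang A w.
Proof.
move=> w; split=> [|hL]; first exact: buchi_lang_sound.
have [[L]|hn] := pselect (exists L, reached A w L = set0).
  exact: empty_reached_accepts.
have r0 l : reached A w l != set0 by apply/eqP => hl; apply: hn; exists l.
pose lexM := exist (fun M => M \in min_models (tacc A)) _ (lex_model_min hMin).
have [r [L hr]] := eventually_tight hL (lexM := lexM) erefl r0.
by apply: (comp_run_accepts (lexM := lexM) _ (fun l Ll => hr l (ltnW Ll))).
Qed.
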